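(* Let $p, q \in \mathbb{R}$. Then $$\int_{0}^{\infty} \left( \frac{t^{p}}{(1+t)^{p}} - \frac{t^{q}}{(1+t)^{q}} \right) \frac{dt}{t} = \psi(q) - \psi(p).$$ Also $$\int_{0}^{\infty} \left( \frac{1}{(1+t)^{p}} - \frac{1}{(1+t)^{q}} \right) \frac{dt}{t} = \psi(q) - \psi(p).$$
   Context: $\psi$ denotes the digamma function, $\psi(x) = \frac{d}{dx}\log\Gamma(x) = \Gamma'(x)/\Gamma(x)$, where $\Gamma$ is the gamma function defined by $\Gamma(x)=\int_0^\infty t^{x-1}e^{-t}\,dt$. The first formula is entry 3.219 in the table of integrals of Gradshteyn and Ryzhik.
   Formalization: The formulas are stated for p, q > 0 instead of all real p, q: Euler's integral defines Γ and ψ only for positive arguments, and for p ≠ q with min(p, q) ≤ 0 both integrals diverge. *)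

(* Defs.v *)
From HB Require Import structures.
From mathcomp Require Import all_boot all_order all_algebra.
From mathcomp Require Import all_classical all_reals all_analysis.

Set Implicit Arguments.
Unset Strict Implicit.
Unset Printing Implicit Defensive.

Import Order.TTheory GRing.Theory Num.Theory.
Import numFieldNormedType.Exports.

Local Open Scope classical_set_scope.
Local Open Scope ring_scope.

(* Euler's integral converges exactly when [0 < x]; for [x <= 0] the integral
   is [+oo] and [Rintegral] returns a default value, so [Gamma] and [digamma]
   are only meaningful at positive arguments. *)
Definition Gamma (R : realType) (x : R) : R :=
  \int[@lebesgue_measure R]_(t in `]0, +oo[) (t `^ (x - 1) * expR (- t)).

Definition digamma (R : realType) (x : R) : R :=
  derive1 (fun y : R => ln (Gamma y)) x.

(* Main.v *)
Require Import Defs.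
From HB Require Import structures.
From mathcomp Require Import all_boot all_order all_algebra.
From mathcomp Require Import all_classical all_reals all_analysis.
From mathcomp Require Import measurable_realfun.
From mathcomp Require Import ring lra.

(** Both formulas are the same integral in two disguises. Let w be x/(1+x) or 1/(1+x).
    Then w (1 - w) (1 + x)^2 = x, so that the integrand (w^p - w^q)/x equals

      (w^(p-1) - w^(q-1)) / (1 - w) * (1 + x)^(-2),

    and under the density (1 + x)^(-2) the variable w is uniform on ]0, 1[: the integral
    of w^(a-1) is 1/a ([integral_inv1D_powR], [integral_frac_powR]). Expanding 1/(1 - w)
    in a geometric series, which has terms of constant sign, gives the sum over k of
    1/(p+k) - 1/(q+k) ([geometric_digamma]).

    It remains to see that this sum is psi(q) - psi(p). Put h = ln Gamma. It satisfies
    h(x+1) = h(x) + ln x ([GammaD1], integration by parts) and it is convex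
    ([ln_Gamma_convex]). In the spirit of the Bohr-Mollerup theorem these two facts
    suffice: convexity pins the slope of h near y = x + n between bounds that differ from
    ln y by O(1/y) ([log_convex_increment]), and the functional equation carries this back
    to x. Hence h is differentiable at x, with derivative the limit of
    ln(x+n) - sum_(k<n) 1/(x+k) ([is_derive_log_convex]). Subtracting these limits at p and q
    gives the series ([cvg_digamma_series]). *)

Set Implicit Arguments.
Unset Strict Implicit.
Unset Printing Implicit Defensive.

Import Order.TTheory GRing.Theory Num.Theory.
Import numFieldNormedType.Exports.

Local Open Scope classical_set_scope.
Local Open Scope ring_scope.

(** * Integration over the positive half-line *)

Section half_line.
Context {R : realType}.
Notation mu := (@lebesgue_measure R).
Implicit Types (f g F : R -> R) (x A B : R).

Lemma is_derive_continuous (f : R -> R) x (df : R) :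
  is_derive x 1 f df -> {for x, continuous f}.
Proof. by move=> [d _]; apply/differentiable_continuous/derivable1_diffP. Qed.

Lemma measurable_0y : (R.-ocitv.-measurable).-sigma.-measurable `](0 : R), +oo[%classic.
Proof. exact: measurable_itv. Qed.

Lemma continuous_measurable_fun_0y f :
  (forall x, 0 < x -> {for x, continuous f}) -> measurable_fun `](0 : R), +oo[ f.
Proof.
move=> cf; apply: subspace_continuous_measurable_fun => //.
apply: continuous_in_subspaceT => x.
by rewrite inE/= in_itv/= andbT; exact: cf.
Qed.

Definition exhaustion (n : nat) : set R := `[n.+2%:R^-1, n.+2%:R]%classic.

Lemma exhaustion_lt n : (n.+2%:R^-1 < n.+2%:R :> R).
Proof.
by rewrite (@lt_trans _ _ 1)// ?invf_lt1// ltr1n.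
Qed.

Lemma bigcup_exhaustion : \bigcup_n exhaustion n = `]0, +oo[%classic :> set R.
Proof.
apply/seteqP; split => [x [n _]|x]; rewrite /exhaustion /= !in_itv/= ?andbT.
  by move=> /andP[+ _]; apply: lt_le_trans; rewrite invr_gt0.
move=> x0; exists (Num.truncn (Num.max x x^-1)).+1 => //=.
have : Num.max x x^-1 < (Num.truncn (Num.max x x^-1)).+3%:R.
  by apply: lt_le_trans (truncnS_gt _) _; rewrite ler_nat ltnS leqW.
rewrite gt_max in_itv/= => /andP[/ltW -> /ltW]; rewrite andbT => h.
by rewrite -[leRHS]invrK lef_pV2// posrE ?invr_gt0.
Qed.

(** The integrands below may blow up at 0, so the fundamental theorem of calculus
    is only available on compact subintervals; monotone convergence recovers the
    whole half-line. *)
Lemma ge0_cvg_integral_exhaustion f :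
  (forall x, 0 < x -> {for x, continuous f}) -> (forall x, 0 < x -> 0 <= f x) ->
  (\int[mu]_(x in exhaustion n) (f x)%:E)%E @[n --> \oo] -->
  (\int[mu]_(x in `]0%R, +oo[) (f x)%:E)%E.
Proof.
move=> cf f0; rewrite -bigcup_exhaustion.
have sub0y i : exhaustion i `<=` `]0, +oo[.
  by rewrite -bigcup_exhaustion; exact: bigcup_sup.
apply: ge0_nondecreasing_set_cvg_integral => //.
- move=> m n mn; apply/subsetPset => x; rewrite /exhaustion/= !in_itv/=.
  move=> /andP[mx xm]; apply/andP; split.
    by apply: le_trans mx; rewrite lef_pV2 ?posrE// ler_nat !ltnS.
  by apply: (le_trans xm); rewrite ler_nat !ltnS.
- by move=> i; apply: measurable_itv.
- move=> i; apply/measurable_EFinP.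
  by apply: measurable_funS (continuous_measurable_fun_0y cf).
- by move=> i x /sub0y/=; rewrite in_itv/= andbT lee_fin => /f0.
Qed.

Lemma integral_exhaustion f F n :
  (forall x, 0 < x -> is_derive x 1 F (f x)) ->
  (forall x, 0 < x -> {for x, continuous f}) ->
  (\int[mu]_(x in exhaustion n) (f x)%:E)%E
  = (F n.+2%:R - F n.+2%:R^-1)%:E.
Proof.
move=> dF cf; have xn_gt0 x : n.+2%:R^-1 <= x -> 0 < x.
  by apply: lt_le_trans; rewrite invr_gt0.
have cF x : 0 < x -> {for x, continuous F} by move=> /dF/is_derive_continuous.
rewrite (@continuous_FTC2 _ f F) ?exhaustion_lt//.
- apply: continuous_in_subspaceT => x.
  by rewrite inE/= in_itv/= => /andP[/xn_gt0 + _]; exact: cf.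
- split.
  + by move=> x; rewrite in_itv/= => /andP[/ltW/xn_gt0/dF[]].
  + by apply: cvg_at_right_filter; apply: cF; exact: xn_gt0.
  + by apply: cvg_at_left_filter; exact: cF.
- move=> x; rewrite in_itv/= => /andP[/ltW/xn_gt0/dF[_ <-]] _.
  by rewrite derive1E.
Qed.

(** The boundary values of the antiderivative are only needed along the
    sequences of endpoints of the exhaustion. *)
Lemma ge0_FTC_0y f F A B :
  (forall x, 0 < x -> is_derive x 1 F (f x)) ->
  (forall x, 0 < x -> {for x, continuous f}) ->
  (forall x, 0 < x -> 0 <= f x) ->
  F n.+2%:R^-1 @[n --> \oo] --> A -> F n.+2%:R @[n --> \oo] --> B ->
  (\int[mu]_(x in `]0%R, +oo[) (f x)%:E)%E = (B - A)%:E.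
Proof.
move=> dF cf f0 FA FB; have := ge0_cvg_integral_exhaustion cf f0.
under eq_cvg do rewrite (integral_exhaustion _ dF cf).
move=> /cvg_unique; apply => //.
by apply: cvg_EFin; [exact: nearW|exact: cvgB].
Qed.

(** This serves for an antiderivative whose derivative changes sign: monotone
    convergence is applied to the two nonnegative parts separately, and their
    integrability makes the difference of the limits meaningful. *)
Lemma FTC_0y_sub f g F A B :
  (forall x, 0 < x -> is_derive x 1 F (f x - g x)) ->
  (forall x, 0 < x -> {for x, continuous f}) ->
  (forall x, 0 < x -> {for x, continuous g}) ->
  (forall x, 0 < x -> 0 <= f x) -> (forall x, 0 < x -> 0 <= g x) ->
  mu.-integrable `]0, +oo[ (EFin \o f) -> mu.-integrable `]0, +oo[ (EFin \o g) ->
  F n.+2%:R^-1 @[n --> \oo] --> A -> F n.+2%:R @[n --> \oo] --> B ->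
  \int[mu]_(x in `]0, +oo[) f x - \int[mu]_(x in `]0, +oo[) g x = B - A.
Proof.
move=> dF cf cg f0 g0 intf intg FA FB.
have fin_f := integrable_fin_num measurable_0y intf.
have fin_g := integrable_fin_num measurable_0y intg.
have cfg : ((\int[mu]_(x in exhaustion n) (f x)%:E -
    \int[mu]_(x in exhaustion n) (g x)%:E) @[n --> \oo] -->
    \int[mu]_(x in `]0%R, +oo[) (f x)%:E -
    \int[mu]_(x in `]0%R, +oo[) (g x)%:E)%E.
  apply: cvgeB (fin_num_adde_defr _ fin_f) _ _.
    exact: ge0_cvg_integral_exhaustion.
  exact: ge0_cvg_integral_exhaustion.
have intS n h : mu.-integrable `]0, +oo[ (EFin \o h) ->
    mu.-integrable (exhaustion n) (EFin \o h).
  apply: integrableS => //; first exact: measurable_itv.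
  by rewrite -bigcup_exhaustion; exact: bigcup_sup.
have step n : (\int[mu]_(x in exhaustion n) (f x)%:E -
    \int[mu]_(x in exhaustion n) (g x)%:E)%E = (F n.+2%:R - F n.+2%:R^-1)%:E.
  rewrite -(integral_exhaustion _ dF); last first.
    by move=> x x0; apply: cvgB; [exact: cf|exact: cg].
  under [RHS]eq_integral do rewrite EFinB.
  rewrite (integralB _ (intS n f intf) (intS n g intg))//.
  exact: measurable_itv.
move: cfg; under eq_cvg do rewrite step.
move=> /cvg_unique cfg.
apply: EFin_inj; rewrite EFinB !fineK//; apply: cfg => //.
by apply: cvg_EFin; [exact: nearW|exact: cvgB].
Qed.

Lemma ge0_integrable_0y f (r : R) : measurable_fun `](0 : R), +oo[ f ->
  (forall x, 0 < x -> 0 <= f x) ->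
  (\int[mu]_(x in `]0%R, +oo[) (f x)%:E)%E = r%:E ->
  mu.-integrable `]0, +oo[ (EFin \o f).
Proof.
move=> mf f0 fr; apply/integrableP; split; first exact/measurable_EFinP.
suff -> : (\int[mu]_(x in `]0%R, +oo[) `|(EFin \o f) x| = r%:E)%E by rewrite ltry.
rewrite -fr; apply: eq_integral => x.
by rewrite inE/= in_itv/= andbT => x0; rewrite ger0_norm// f0.
Qed.

Lemma eq_integral_0y f g (l : \bar R) : (forall x, 0 < x -> f x = g x) ->
  mu.-integrable `]0, +oo[ (EFin \o f) /\
    (\int[mu]_(x in `]0%R, +oo[) (f x)%:E)%E = l ->
  mu.-integrable `]0, +oo[ (EFin \o g) /\
    (\int[mu]_(x in `]0%R, +oo[) (g x)%:E)%E = l.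
Proof.
move=> fg [i <-].
have E x : x \in `](0 : R), +oo[%classic -> (f x)%:E = (g x)%:E.
  by rewrite inE/= in_itv/= andbT => /fg ->.
split; first by apply: eq_integrable i => // x /E.
by apply: eq_integral => x /E.
Qed.

End half_line.

(** * Powers of t/(1+t) and 1/(1+t) *)

Section unit_interval_powers.
Context {R : realType}.
Notation mu := (@lebesgue_measure R).
Implicit Types (w d : R -> R) (a b c x A B : R).

Lemma is_derive_powR_comp w b x (dw : R) : 0 < w x -> is_derive x 1 w dw ->
  is_derive x 1 (fun y => w y `^ b) (b * w x `^ (b - 1) * dw).
Proof.
by move=> w0 dwx; exact: is_derive1_comp (is_derive1_powR b w0) dwx.
Qed.

(** The substitution u = w x. The factor c records the orientation: c = 1 when w
    increases and c = -1 when it decreases, so that the density d is nonnegative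
    in both cases. *)
Lemma integral_powR_derive w d c a A B : 0 < a -> c != 0 ->
  (forall x, 0 < x -> 0 < w x) -> (forall x, 0 < x -> 0 <= d x) ->
  (forall x, 0 < x -> is_derive x 1 w (c * d x)) ->
  (forall x, 0 < x -> {for x, continuous d}) ->
  w n.+2%:R^-1 `^ a @[n --> \oo] --> A -> w n.+2%:R `^ a @[n --> \oo] --> B ->
  (\int[mu]_(x in `]0%R, +oo[) (w x `^ (a - 1) * d x)%:E)%E
  = ((B - A) / (a * c))%:E.
Proof.
move=> a0 c0 w0 d0 dw cd wA wB.
have dP b x : 0 < x -> is_derive x 1 (fun y => w y `^ b)
    (b * w x `^ (b - 1) * (c * d x)).
  by move=> x0; exact: is_derive_powR_comp (w0 _ x0) (dw _ x0).
rewrite mulrBl.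
apply: (@ge0_FTC_0y _ _ (fun x => w x `^ a / (a * c))).
- move=> x x0.
  have -> : (fun x => w x `^ a / (a * c)) = (a * c)^-1 \*: (fun x => w x `^ a).
    by apply/funext => y /=; rewrite /GRing.scale/= mulrC.
  apply: (is_derive_eq (is_deriveZ _ (dP a x x0))).
  by rewrite /GRing.scale/=; field; rewrite c0 gt_eqF.
- move=> x x0; apply: cvgM; last exact: cd.
  exact: (is_derive_continuous (dP (a - 1) x x0)).
- by move=> x x0; rewrite mulr_ge0 ?powR_ge0// d0.
- by apply: cvgM => //; exact: cvg_cst.
- by apply: cvgM => //; exact: cvg_cst.
Qed.

Lemma cvg_invS3 : (n.+3%:R : R)^-1 @[n --> \oo] --> (0 : R).
Proof.
by have := @cvg_harmonic R; rewrite -cvg_shiftS -cvg_shiftS.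
Qed.

Lemma cvg_invS3_powR a : 0 < a -> (n.+3%:R : R)^-1 `^ a @[n --> \oo] --> (0 : R).
Proof.
move=> a0; apply: (cvg_comp _ _ _ (powR_cvg0 a0)) => P P0.
have := cvg_invS3 P0; apply: (@filterS _ \oo) => n; apply.
by rewrite /= invr_gt0.
Qed.

Lemma cvg_1BinvS3_powR a : (1 - (n.+3%:R : R)^-1) `^ a @[n --> \oo] --> (1 : R).
Proof.
have /is_derive_continuous c : is_derive (1 : R) (1 : R) (@powR R ^~ a) (a * 1 `^ (a - 1)).
  exact: is_derive1_powR ltr01.
move: c; rewrite /prop_for /continuous_at powR1 => c.
apply: (cvg_comp _ _ _ c).
by have := cvgB (cvg_cst (1 : R)) cvg_invS3; rewrite subr0; apply.
Qed.

Lemma is_derive_inv1D x : 0 < x ->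
  is_derive x 1 (fun t : R => (1 + t)^-1) (-1 * (1 + x) ^- 2).
Proof.
move=> x0.
have d1 : is_derive x 1 (fun t : R => 1 + t) 1.
  by apply: (is_derive_eq (is_deriveD (is_derive_cst _ _ _) (is_derive_id _ _))); rewrite add0r.
have n0 : 1 + x != 0 by rewrite gt_eqF// addr_gt0.
by apply: (is_derive_eq (is_deriveV n0 d1)); rewrite /GRing.scale/= mulr1 mulN1r.
Qed.

Lemma is_derive_frac x : 0 < x ->
  is_derive x 1 (fun t : R => 1 - (1 + t)^-1) (1 * (1 + x) ^- 2).
Proof.
move=> x0.
apply: (is_derive_eq (is_deriveB (is_derive_cst _ _ _) (is_derive_inv1D x0))).
by rewrite sub0r mulN1r opprK mul1r.
Qed.

Lemma continuous_inv1D2 x : 0 < x -> {for x, continuous (fun t : R => (1 + t) ^- 2)}.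
Proof.
move=> x0.
have -> : (fun t : R => (1 + t) ^- 2) = (fun t : R => (1 + t)^-1 * (1 + t)^-1).
  by apply/funext => t; rewrite expr2 invfM.
by apply: cvgM; exact: is_derive_continuous (is_derive_inv1D x0).
Qed.

(** The inversion x |-> 1/x exchanges 1/(1+x) and x/(1+x), hence the two ends of the
    exhaustion. *)
Lemma inv1D_inv (m : R) : 0 < m -> (1 + m^-1)^-1 = 1 - (1 + m)^-1.
Proof. by move=> m0; field; lra. Qed.

(** In probabilistic terms, 1/(1+x) and x/(1+x) both push the measure dx/(1+x)^2
    forward to the uniform law on ]0, 1[. *)
Lemma integral_inv1D_powR a : 0 < a ->
  (\int[mu]_(x in `]0%R, +oo[) ((1 + x)^-1 `^ (a - 1) * (1 + x) ^- 2)%:E)%E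
  = (a^-1)%:E.
Proof.
move=> a0.
have -> : a^-1 = (0 - 1) / (a * (-1)) by field; rewrite gt_eqF.
apply: (@integral_powR_derive (fun x => (1 + x)^-1)) => //.
- by move=> x x0; rewrite invr_gt0 addr_gt0.
- by move=> x x0; rewrite invr_ge0 exprn_ge0// addr_ge0// ltW.
- exact: is_derive_inv1D.
- exact: continuous_inv1D2.
- under eq_cvg do rewrite inv1D_inv// nat1r.
  exact: cvg_1BinvS3_powR.
- under eq_cvg do rewrite nat1r.
  exact: cvg_invS3_powR.
Qed.

Lemma integral_frac_powR a : 0 < a ->
  (\int[mu]_(x in `]0%R, +oo[) ((1 - (1 + x)^-1) `^ (a - 1) * (1 + x) ^- 2)%:E)%E
  = (a^-1)%:E.
Proof.
move=> a0.
have -> : a^-1 = (1 - 0) / (a * 1) by field; rewrite gt_eqF.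
apply: (@integral_powR_derive (fun x => 1 - (1 + x)^-1)) => //.
- by move=> x x0; rewrite subr_gt0 invf_lt1 ?addr_gt0// ltrDl.
- by move=> x x0; rewrite invr_ge0 exprn_ge0// addr_ge0// ltW.
- exact: is_derive_frac.
- exact: continuous_inv1D2.
- under eq_cvg do rewrite inv1D_inv// subKr nat1r.
  exact: cvg_invS3_powR.
- under eq_cvg do rewrite nat1r.
  exact: cvg_1BinvS3_powR.
Qed.

End unit_interval_powers.

(** * The Gamma function: positivity, functional equation, log-convexity *)

Section Gamma.
Context {R : realType}.
Notation mu := (@lebesgue_measure R).
Implicit Types (b s t x y : R).

Definition Euler_integrand x t := t `^ (x - 1) * expR (- t).

Lemma Euler_integrand_gt0 x t : 0 < t -> 0 < Euler_integrand x t.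
Proof. by move=> t0; rewrite mulr_gt0 ?powR_gt0 ?expR_gt0. Qed.

Lemma is_derive_expRN t : is_derive t 1 (fun s => expR (- s)) (- expR (- t)).
Proof.
apply: (is_derive_eq (is_derive1_comp (is_derive_expR _) (is_deriveN (is_derive_id _ _)))).
by rewrite mulrN1.
Qed.

Lemma continuous_Euler_integrand x t : 0 < t ->
  {for t, continuous (Euler_integrand x)}.
Proof.
move=> t0; apply: cvgM.
  exact: is_derive_continuous (is_derive1_powR (x - 1) t0).
exact: is_derive_continuous (is_derive_expRN t).
Qed.

(** For b > 0, the maximum of s^b exp(1 - s) over s > 0, attained at s = b. *)
Definition powR_expR_bound b : R := expR (1 + b * ln b - b).

Lemma powR_expR_le b t : 0 < b -> 0 < t ->
  (1 + t) `^ b * expR (- t) <= powR_expR_bound b.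
Proof.
move=> b0 t0; have t1 : 0 < 1 + t by rewrite addr_gt0.
rewrite /powR gt_eqF// -expRD ler_expR.
have h : ln ((1 + t) / b) <= (1 + t) / b - 1.
  have := @le_ln1Dx R ((1 + t) / b - 1); rewrite subrKC; apply.
  by rewrite ltrBDl addrN divr_gt0.
rewrite ln_div ?posrE// in h.
have := ler_wpM2l (ltW b0) h.
rewrite !mulrBr mulrCA mulfV ?gt_eqF//; lra.
Qed.

(** The dominating function is chosen because its integral is the power moment
    computed above; it gives integrability at 0 and at infinity at once. *)
Lemma Euler_integrand_le x t : 0 < x -> 0 < t -> Euler_integrand x t
  <= powR_expR_bound (x + 1) * ((1 - (1 + t)^-1) `^ (x - 1) * (1 + t) ^- 2).
Proof.
move=> x0 t0; have t1 : 0 < 1 + t by rewrite addr_gt0.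
have -> : Euler_integrand x t = ((1 + t) `^ (x + 1) * expR (- t)) *
    ((1 - (1 + t)^-1) `^ (x - 1) * (1 + t) ^- 2).
  have -> : x + 1 = x - 1 + 2%:R by lra.
  rewrite powRD; last by apply/implyP => _; rewrite gt_eqF.
  rewrite powR_mulrn ?ltW// /Euler_integrand.
  have {1}-> : t = (1 + t) * (1 - (1 + t)^-1) by field; rewrite gt_eqF.
  rewrite powRM ?ltW//; last by rewrite subr_gt0 invf_lt1// ltrDl.
  by field; rewrite gt_eqF.
apply: ler_wpM2r; last by apply: powR_expR_le => //; lra.
by rewrite mulr_ge0 ?powR_ge0// invr_ge0 exprn_ge0// ltW.
Qed.

Lemma integrable_frac_powR x : 0 < x -> mu.-integrable `]0, +oo[
  (fun t => ((1 - (1 + t)^-1) `^ (x - 1) * (1 + t) ^- 2)%:E).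
Proof.
move=> x0; apply: (ge0_integrable_0y _ _ (integral_frac_powR x0)) => [|t t0].
  apply: continuous_measurable_fun_0y => t t0.
  apply: cvgM; last exact: continuous_inv1D2.
  have h : 0 < 1 - (1 + t)^-1.
    by rewrite subr_gt0 invf_lt1 ?addr_gt0// ltrDl.
  have dw := @is_derive_powR_comp _ (fun t => 1 - (1 + t)^-1) (x - 1) t _ h
    (is_derive_frac t0).
  exact: is_derive_continuous dw.
by rewrite mulr_ge0 ?powR_ge0// invr_ge0 exprn_ge0// addr_ge0// ltW.
Qed.

Lemma integrable_Euler x : 0 < x ->
  mu.-integrable `]0, +oo[ (EFin \o Euler_integrand x).
Proof.
move=> x0; have := integrableZl measurable_0y (powR_expR_bound (x + 1))
  (integrable_frac_powR x0).
apply: le_integrable => //.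
  apply/measurable_EFinP; apply: continuous_measurable_fun_0y => t t0.
  exact: continuous_Euler_integrand.
move=> t /=; rewrite in_itv/= andbT => t0.
rewrite lee_fin (le_trans _ (ler_norm _))// ger0_norm ?Euler_integrand_le//.
exact/ltW/Euler_integrand_gt0.
Qed.

(** Euler's integrand is bounded below by a positive constant on [1, 2]. *)
Lemma Gamma_gt0 x : 0 < x -> 0 < Gamma x.
Proof.
move=> x0; pose c := expR (- `|x - 1| - 2).
have le_c t : 1 <= t <= 2 -> c <= Euler_integrand x t.
  move=> /andP[t1 t2]; have t0 : 0 < t by rewrite (lt_le_trans ltr01).
  rewrite /Euler_integrand /powR gt_eqF// -expRD ler_expR.
  suff : `|(x - 1) * ln t| <= `|x - 1| by rewrite ler_norml => /andP[]; lra.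
  rewrite normrM (ger0_norm (ln_ge0 t1)) ler_piMr//.
  have := @le_ln1Dx R (t - 1); rewrite subrKC => h.
  by apply: le_trans (h _) _; lra.
have -> : Gamma x = \int[mu]_(t in `]0, +oo[) Euler_integrand x t by [].
rewrite -lte_fin fineK ?(integrable_fin_num _ (integrable_Euler x0))//.
have mE : measurable_fun `](0:R), +oo[ (EFin \o Euler_integrand x).
  by case/integrableP: (integrable_Euler x0).
have sub : `[1%R, 2%R] `<=` `](0:R), +oo[.
  by move=> t /=; rewrite !in_itv/= andbT => /andP[]; lra.
apply: (@lt_le_trans _ _ (\int[mu]_(t in `[1%R, 2%R]) (cst c%:E) t)%E).
  rewrite integral_cst//= lebesgue_measure_itv/= lte_fin ltr1n.
  by rewrite -EFinB -EFinM lte_fin mulr_gt0 ?expR_gt0//; lra.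
apply: (@le_trans _ _ (\int[mu]_(t in `[1%R, 2%R]) (Euler_integrand x t)%:E)%E).
  apply: ge0_le_integral => //.
  - by move=> t _; rewrite lee_fin ltW// expR_gt0.
  - exact: (measurable_funS measurable_0y sub mE).
apply: ge0_subset_integral => //.
by move=> t /=; rewrite in_itv/= andbT lee_fin => /Euler_integrand_gt0 /ltW; apply.
Qed.

(** Integration by parts: F t = t^x exp(-t) vanishes at both ends and has derivative
    x t^(x-1) exp(-t) - t^x exp(-t). *)
Lemma GammaD1 x : 0 < x -> Gamma (x + 1) = x * Gamma x.
Proof.
move=> x0; pose F t := t `^ x * expR (- t).
have F_le t : 0 < t ->
    0 <= F t <= powR_expR_bound (x + 1) * ((1 - (1 + t)^-1) `^ x * (1 + t)^-1).
  move=> t0; have t1 : 0 < 1 + t by rewrite addr_gt0.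
  rewrite /F mulr_ge0 ?powR_ge0 ?expR_ge0//=.
  have -> : t `^ x * expR (- t) = ((1 + t) `^ (x + 1) * expR (- t)) *
    ((1 - (1 + t)^-1) `^ x * (1 + t)^-1).
    rewrite powRD; last by apply/implyP => _; rewrite gt_eqF.
    rewrite powRr1 ?ltW//.
    have {1}-> : t = (1 + t) * (1 - (1 + t)^-1) by field; rewrite gt_eqF.
    rewrite powRM ?ltW//; last by rewrite subr_gt0 invf_lt1// ltrDl.
    by field; rewrite gt_eqF.
  apply: ler_wpM2r; last by apply: powR_expR_le => //; lra.
  by rewrite mulr_ge0 ?powR_ge0// invr_ge0 ltW.
have ix := integrable_Euler x0.
have x10 : 0 < x + 1 by lra.
have ix1 := integrable_Euler x10.
have : \int[mu]_(t in `]0, +oo[) (x * Euler_integrand x t)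
    - \int[mu]_(t in `]0, +oo[) Euler_integrand (x + 1) t = 0 - 0.
  apply: (@FTC_0y_sub R (fun t => x * Euler_integrand x t)
    (Euler_integrand (x + 1)) F) => //.
  - move=> t t0.
    apply: (is_derive_eq (is_deriveM (is_derive1_powR x t0) (is_derive_expRN t))).
    by rewrite /Euler_integrand addrK /GRing.scale/=; ring.
  - by move=> t t0; apply: cvgM; [exact: cvg_cst|exact: continuous_Euler_integrand].
  - by move=> t t0; exact: continuous_Euler_integrand.
  - by move=> t t0; rewrite mulr_ge0 ?ltW// Euler_integrand_gt0.
  - by move=> t t0; rewrite ltW// Euler_integrand_gt0.
  - exact: (integrableZl measurable_0y x ix).
  - apply: (@squeeze_cvgr _ _ _ _ (cst 0) (fun n => powR_expR_bound (x + 1) * n.+3%:R^-1 `^ x)).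
    + apply: nearW => n /=.
      have n0 : 0 < (n.+2%:R^-1 : R) by rewrite invr_gt0.
      have /andP[-> /le_trans] /= := F_le _ n0; apply.
      rewrite ler_wpM2l ?expR_ge0// inv1D_inv// subKr nat1r.
      rewrite ler_piMr ?powR_ge0//.
    + exact: cvg_cst.
    + rewrite -[X in _ --> X](mulr0 (powR_expR_bound (x + 1))).
      by apply: cvgM; [exact: cvg_cst|exact: cvg_invS3_powR].
  - apply: (@squeeze_cvgr _ _ _ _ (cst 0) (fun n => powR_expR_bound (x + 1) * n.+3%:R^-1)).
    + apply: nearW => n /=.
      have n0 : 0 < (n.+2%:R : R) by [].
      have /andP[-> /le_trans] /= := F_le _ n0; apply.
      rewrite ler_wpM2l ?expR_ge0// nat1r ler_piMl ?invr_ge0//.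
      have le1 : (n.+3%:R^-1 : R) <= 1 by rewrite invf_le1// ler1n.
      have ge0 : (0 : R) <= n.+3%:R^-1 by rewrite invr_ge0.
      have := @ge0_ler_powR R x (ltW x0) (1 - n.+3%:R^-1) 1.
      by rewrite powR1 !nnegrE; apply; rewrite ?subr_ge0// gerBl.
    + exact: cvg_cst.
    + rewrite -[X in _ --> X](mulr0 (powR_expR_bound (x + 1))).
      by apply: cvgM; [exact: cvg_cst|exact: cvg_invS3].
rewrite RintegralZl// subr0 => /eqP; rewrite subr_eq0 => /eqP /esym.
exact.
Qed.

(** Pointwise weighted arithmetic-geometric inequality. Integrated with A = Gamma x
    and B = Gamma y it gives log-convexity, as in the proof of Hoelder's
    inequality. *)
Lemma Euler_integrand_mix x y s t (A B : R) : 0 <= s <= 1 -> 0 < t ->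
  0 < A -> 0 < B ->
  Euler_integrand ((1 - s) * x + s * y) t <=
  expR ((1 - s) * ln A + s * ln B) *
    ((1 - s) / A * Euler_integrand x t + s / B * Euler_integrand y t).
Proof.
move=> /andP[s0 s1] t0 A0 B0.
have E w : Euler_integrand w t = expR ((w - 1) * ln t - t).
  by rewrite /Euler_integrand /powR gt_eqF// -expRD.
pose X := (x - 1) * ln t - t - ln A; pose Y := (y - 1) * ln t - t - ln B.
pose Z := (1 - s) * X + s * Y.
have EX : A^-1 * Euler_integrand x t = expR X.
  by rewrite E /X [in RHS]expRD expRN lnK// mulrC.
have EY : B^-1 * Euler_integrand y t = expR Y.
  by rewrite E /Y [in RHS]expRD expRN lnK// mulrC.
rewrite -!mulrA EX EY E.
have -> : ((1 - s) * x + s * y - 1) * ln t - t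
    = ((1 - s) * ln A + s * ln B) + Z.
  by rewrite /Z /X /Y; ring.
rewrite expRD ler_wpM2l ?expR_ge0//.
(* The graph of exp lies above its tangent at the barycentre Z. *)
have tangent W : expR Z * (1 + (W - Z)) <= expR W.
  have -> : expR W = expR Z * expR (W - Z) by rewrite -expRD subrKC.
  by rewrite ler_wpM2l ?expR_ge0// expR_ge1Dx.
have -> : expR Z = (1 - s) * (expR Z * (1 + (X - Z))) + s * (expR Z * (1 + (Y - Z))).
  have mean0 : (1 - s) * (X - Z) + s * (Y - Z) = 0 by rewrite /Z; ring.
  by rewrite -[LHS]mulr1 -[1 in LHS]addr0 -[0 in LHS]mean0; ring.
by rewrite lerD// ler_wpM2l// subr_ge0.
Qed.

Lemma ln_Gamma_convex x y s : 0 < x -> 0 < y -> 0 <= s <= 1 ->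
  ln (Gamma ((1 - s) * x + s * y)) <= (1 - s) * ln (Gamma x) + s * ln (Gamma y).
Proof.
move=> x0 y0 s01; have /andP[s0 s1] := s01.
have z0 : 0 < (1 - s) * x + s * y.
  have [s_eq0|sN0] := eqVneq s 0; first by rewrite s_eq0; lra.
  by rewrite ltr_wpDl ?mulr_ge0 ?mulr_gt0 ?lt_def ?sN0//; lra.
rewrite -ler_expR lnK ?posrE ?Gamma_gt0//.
have ix := integrable_Euler x0; have iy := integrable_Euler y0.
have sx := integrableZl measurable_0y ((1 - s) / Gamma x) ix.
have sy := integrableZl measurable_0y (s / Gamma y) iy.
have sxy := integrableD measurable_0y sx sy.
apply: (@le_trans _ _ (\int[mu]_(t in `]0, +oo[)
  (expR ((1 - s) * ln (Gamma x) + s * ln (Gamma y)) *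
   ((1 - s) / Gamma x * Euler_integrand x t +
    s / Gamma y * Euler_integrand y t)))).
  apply: le_Rintegral => //.
  - exact: integrable_Euler.
  - exact: integrableZl measurable_0y _ _ sxy.
  - move=> t /=; rewrite in_itv/= andbT => t0.
    by apply: Euler_integrand_mix; rewrite ?Gamma_gt0.
rewrite RintegralZl// RintegralD// RintegralZl// RintegralZl//.
rewrite -/(Gamma x) -/(Gamma y).
by rewrite !divfK ?gt_eqF ?Gamma_gt0// subrK mulr1.
Qed.

End Gamma.

(** * Differentiating a convex solution of h (x + 1) = h x + ln x *)

Section log_convex_solution.
Context {R : realType} (h : R -> R).
Context (hD1 : forall x, 0 < x -> h (x + 1) = h x + ln x).
Context (h_convex : forall x y s, 0 < x -> 0 < y -> 0 <= s <= 1 ->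
  h ((1 - s) * x + s * y) <= (1 - s) * h x + s * h y).
Implicit Types (x y p q : R) (n : nat).

Lemma log_convex_shift x n : 0 < x -> h x = h (x + n%:R) - \sum_(k < n) ln (x + k%:R).
Proof.
move=> x0; elim: n => [|n IHn]; first by rewrite big_ord0 addr0 subr0.
rewrite IHn big_ord_recr/= -natr1 addrA hD1 ?ltr_wpDr//.
ring.
Qed.

Lemma ln_sub_le x y : 0 < x -> 0 < y -> ln y - ln x <= (y - x) / x.
Proof.
move=> x0 y0; rewrite -ln_div ?posrE//.
have -> : y / x = 1 + (y - x) / x by field; rewrite gt_eqF.
by apply: le_ln1Dx; rewrite ltr_pdivlMr// mulN1r ltrBrDr addNr.
Qed.

(** On [y, y + 1] convexity puts h below its chord, whose slope is ln y. *)
Lemma log_convex_increment_le y s : 0 < y -> 0 <= s <= 1 -> h (y + s) <= h y + s * ln y.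
Proof.
move=> y0 s01; have y10 : 0 < y + 1 by rewrite addr_gt0.
have := h_convex y0 y10 s01; rewrite hD1//.
have -> : (1 - s) * y + s * (y + 1) = y + s by ring.
by have -> : (1 - s) * h y + s * (h y + ln y) = h y + s * ln y by ring.
Qed.

(** The upper bound on the step of length 1 - s from y + s to y + 1 gives the slope
    ln (y + s) there, which exceeds ln y by at most s / y. *)
Lemma log_convex_increment_ge y s : 0 < y -> 0 <= s <= 1 -> h y + s * (ln y - y^-1) <= h (y + s).
Proof.
move=> y0 /andP[s0 s1]; have ys0 : 0 < y + s by rewrite ltr_wpDr.
have s'01 : 0 <= 1 - s <= 1 by lra.
have := log_convex_increment_le ys0 s'01; rewrite -addrA subrKC hD1//.
have := ln_sub_le y0 ys0; rewrite [y + s]addrC addrK => h1 h2.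
have s'0 : 0 <= 1 - s by lra.
have := ler_wpM2l s'0 h1.
have : 0 <= s * (s / y) by rewrite !mulr_ge0// invr_ge0 ltW.
rewrite [s + y]addrC in h1 h2 *; lra.
Qed.

(** Chords of h from y have slope ln y up to an error uniform in the step that tends
    to 0 as y grows. This is what makes h differentiable. For a step to the left, the
    two preceding bounds are taken at y + e. *)
Lemma log_convex_increment y e : 1 < y -> `|e| <= 1 ->
  `|h (y + e) - h y - e * ln y| <= `|e| * (2 / (y - 1)).
Proof.
move=> y1 e1; have y0 : 0 < y by lra.
have y10 : 0 < y - 1 by lra.
have iy : y^-1 <= (y - 1)^-1 by rewrite lef_pV2 ?posrE//; lra.
have iy0 : 0 < y^-1 by rewrite invr_gt0.
have [e0|e0] := leP 0 e.
  have e01 : 0 <= e <= 1 by rewrite e0 -(ger0_norm e0).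
  rewrite (ger0_norm e0) ler_norml.
  have := log_convex_increment_le y0 e01; have := log_convex_increment_ge y0 e01.
  have := ler_wpM2l e0 iy; have : 0 <= e * y^-1 by rewrite mulr_ge0// ltW.
  by move=> *; apply/andP; split; lra.
move: e1; rewrite (ltr0_norm e0) => e1.
have eN0 : 0 <= - e by rewrite oppr_ge0 ltW.
have e01 : 0 <= - e <= 1 by rewrite e1 eN0.
have ye0 : 0 < y + e by lra.
have ie : (y + e)^-1 <= (y - 1)^-1 by rewrite lef_pV2 ?posrE//; lra.
have := log_convex_increment_le ye0 e01; have := log_convex_increment_ge ye0 e01.
rewrite addrK => h1 h2.
have h3 : ln (y + e) <= ln y by rewrite ler_ln ?posrE//; lra.
have h4 : ln y - ln (y + e) <= (y - 1)^-1.
  apply: le_trans (ln_sub_le ye0 y0) _.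
  rewrite opprD addNKr; apply: le_trans ie.
  by rewrite ler_piMl// invr_ge0 ltW.
have := ler_wpM2l eN0 ie; have := ler_wpM2l eN0 h3; have := ler_wpM2l eN0 h4.
rewrite ler_norml => *; apply/andP; split; lra.
Qed.

(** The n-th approximation in Gauss' formula for the digamma function: ln (x + n) is
    almost the slope of h at x + n, and the functional equation transports it
    back to x. *)
Definition digamma_seq x n : R := ln (x + n%:R) - \sum_(k < n) (x + k%:R)^-1.

Lemma digamma_seq_nonincreasing x : 0 < x -> nonincreasing_seq (digamma_seq x).
Proof.
move=> x0; apply/nonincreasing_seqP => n; rewrite /digamma_seq big_ord_recr/=.
have xn : 0 < x + n%:R by rewrite ltr_wpDr.
have xn1 : 0 < x + n.+1%:R by rewrite ltr_wpDr.
have := ln_sub_le xn xn1.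
have -> : x + n.+1%:R - (x + n%:R) = 1 by rewrite -natr1; ring.
by rewrite mul1r; lra.
Qed.

(** Comparison of the harmonic sum with the logarithm. *)
Lemma digamma_seq_ge x n : 0 < x -> ln x - x^-1 <= digamma_seq x n.
Proof.
move=> x0; have S m : \sum_(k < m.+1) (x + k%:R)^-1 <= ln (x + m%:R) - ln x + x^-1.
  elim: m => [|m IHm].
    by rewrite big_ord_recr/= big_ord0 addr0 subrr !add0r.
  rewrite big_ord_recr/=.
  have xm : 0 < x + m%:R by rewrite ltr_wpDr.
  have xm1 : 0 < x + m.+1%:R by rewrite ltr_wpDr.
  have := ln_sub_le xm1 xm.
  have -> : x + m%:R - (x + m.+1%:R) = -1 by rewrite -natr1; ring.
  by rewrite mulN1r; lra.
case: n => [|n]; rewrite /digamma_seq.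
  by rewrite big_ord0 addr0 subr0 gerBl invr_ge0 ltW.
have := S n; have : ln (x + n%:R) <= ln (x + n.+1%:R).
  by rewrite ler_ln ?posrE ?ltr_wpDr// lerD2l ler_nat.
lra.
Qed.

Lemma is_cvg_digamma_seq x : 0 < x -> cvgn (digamma_seq x).
Proof.
move=> x0; apply: nonincreasing_is_cvgn; first exact: digamma_seq_nonincreasing.
by exists (ln x - x^-1) => _ [n _ <-]; exact: digamma_seq_ge.
Qed.

Lemma cvg_inv_natD x : (x + n%:R)^-1 @[n --> \oo] --> (0 : R).
Proof.
have xy : (x + n%:R) @[n --> \oo] --> +oo.
  exact: (cvg_comp _ _ cvgr_idn (cvg_addrl x)).
by apply/gtr0_cvgV0 => //; move/cvgryPgt : xy; apply.
Qed.

Lemma is_derive_sum_ln x n : 0 < x ->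
  is_derive x 1 (fun y => \sum_(k < n) ln (y + k%:R)) (\sum_(k < n) (x + k%:R)^-1).
Proof.
move=> x0.
have -> : (fun y => \sum_(k < n) ln (y + k%:R)) =
    \sum_(k < n) (fun y : R => ln (y + k%:R)).
  by apply/funext => y; rewrite fct_sumE.
apply: is_derive_sum => k.
have xk : 0 < x + k%:R by rewrite ltr_wpDr.
have d1 : is_derive x 1 (fun y : R => y + k%:R) 1.
  by apply: (is_derive_eq (is_deriveD (is_derive_id _ _) (is_derive_cst _ _ _))); rewrite addr0.
have := @is_derive1_comp R (@ln R) (fun y => y + k%:R) x _ _ (is_derive1_ln xk) d1.
by rewrite mulr1.
Qed.

Lemma is_derive_cvg (f : R -> R) x (df : R) :
  is_derive x 1 f df <-> e^-1 * (f (x + e) - f x) @[e --> 0^'] --> df.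
Proof.
have -> : (fun e => e^-1 * (f (x + e) - f x)) =
    (fun e => e^-1 *: ((f \o shift x) (e *: 1) - f x)).
  by apply/funext => e; rewrite /= /GRing.scale/= mulr1 [e + x]addrC.
split=> [[/[swap] <-]//|c].
by split; [apply/cvg_ex; exists df|exact/cvg_lim].
Qed.

(** For fixed n the difference quotient of h at x is the one at x + n minus the
    difference quotient of a finite sum of logarithms. The first is within
    2 / (x + n - 1) of ln (x + n); the second converges. Thus all limit points of the
    quotient are within 2 / (x + n - 1) of the n-th approximation, for every n. *)
Lemma is_derive_log_convex x : 0 < x -> is_derive x 1 h (limn (digamma_seq x)).
Proof.
move=> x0; set L := limn _.
apply/is_derive_cvg/cvgrPdist_le => eps eps0.
have eps3 : 0 < eps / 3 by rewrite divr_gt0.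
have /filter_ex [n [xn1 close_n psi_n]] : \forall n \near \oo,
    [/\ 1 < x + n%:R, (x - 1 + n%:R)^-1 * 2 <= eps / 3
      & `|L - digamma_seq x n| <= eps / 3].
  near=> n; split.
  - rewrite -ltrBlDl; near: n; exact: nbhs_infty_gtr.
  - rewrite -ler_pdivlMr//; apply: le_trans (ler_norm _) _.
    rewrite -normrN -sub0r.
    near: n; have /cvgrPdist_le := @cvg_inv_natD (x - 1); apply.
    by rewrite divr_gt0.
  - near: n; have /cvgrPdist_le := is_cvg_digamma_seq x0; exact.
have /is_derive_cvg/cvgrPdist_le/(_ _ eps3) dS := is_derive_sum_ln n x0.
near=> e.
have e_neq0 : e != 0 by near: e; exact: nbhs_dnbhs_neq.
have e_small : `|e| < Num.min 1 x.
  near: e; apply: dnbhs0_lt; by rewrite lt_min ltr01.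
move: e_small; rewrite lt_min => /andP[/ltW e1 ex].
have xe0 : 0 < x + e.
  by move: ex; rewrite ltr_norml => /andP[]; rewrite -subr_gt0 opprK addrC.
have : `|\sum_(k < n) (x + k%:R)^-1 -
    e^-1 * (\sum_(k < n) ln (x + e + k%:R) - \sum_(k < n) ln (x + k%:R))| <= eps / 3.
  by near: e; exact: dS.
set S' := \sum_(k < n) (x + k%:R)^-1; set Se := \sum_(k < n) ln (x + e + k%:R).
set S := \sum_(k < n) ln (x + k%:R) => dSe.
have := log_convex_increment xn1 e1; set D := (X in `|X| <= _) => De.
rewrite (log_convex_shift n xe0) (log_convex_shift n x0) -/S -/Se.
have -> : L - e^-1 * (h (x + e + n%:R) - Se - (h (x + n%:R) - S)) =
    (L - digamma_seq x n) - e^-1 * D - (S' - e^-1 * (Se - S)).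
  by rewrite /D /digamma_seq -/S' [x + n%:R + e]addrAC; field.
have De' : `|e^-1 * D| <= eps / 3.
  apply: le_trans close_n; rewrite normrM normfV ler_pdivrMl ?normr_gt0//.
  by apply: le_trans De _; rewrite [_^-1 * 2]mulrC addrAC.
apply: le_trans (ler_normB _ _) _; apply: le_trans (lerD (ler_normB _ _) (lexx _)) _.
lra.
Unshelve. all: by end_near. Qed.

(** The logarithms ln (q + n) and ln (p + n) of the two approximations cancel in the
    limit. *)
Lemma cvg_digamma_series p q : 0 < p -> p <= q ->
  \sum_(k < n) ((p + k%:R)^-1 - (q + k%:R)^-1) @[n --> \oo] -->
  limn (digamma_seq q) - limn (digamma_seq p).
Proof.
move=> p0 pq; have q0 := lt_le_trans p0 pq.
have -> : (fun n => \sum_(k < n) ((p + k%:R)^-1 - (q + k%:R)^-1)) =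
   (fun n => digamma_seq q n - digamma_seq p n - (ln (q + n%:R) - ln (p + n%:R))).
  by apply/funext => n; rewrite sumrB /digamma_seq; ring.
rewrite -[X in _ --> X]subr0; apply: cvgB.
  by apply: cvgB; exact: is_cvg_digamma_seq.
apply: (@squeeze_cvgr _ _ _ _ (cst 0) (fun n => (q - p) * (p + n%:R)^-1)).
- near=> n; have pn : 0 < p + n%:R by rewrite ltr_wpDr.
  have qn : 0 < q + n%:R by rewrite ltr_wpDr.
  rewrite subr_ge0 ler_ln ?posrE// lerD2r pq/=.
  have -> : q - p = q + n%:R - (p + n%:R) by ring.
  exact: ln_sub_le.
- exact: cvg_cst.
- rewrite -[X in _ --> X](mulr0 (q - p)).
  by apply: cvgM; [exact: cvg_cst|exact: cvg_inv_natD].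
Unshelve. all: by end_near. Qed.

End log_convex_solution.

(** The logarithmic derivative comes from log-convexity and the functional equation,
    without differentiating Euler's integral in its parameter. *)
Lemma digammaE (R : realType) (x : R) : 0 < x ->
  digamma x = limn (digamma_seq x).
Proof.
move=> x0; rewrite /digamma derive1E.
apply: derive_val; apply: is_derive_log_convex => //.
- by move=> y y0; rewrite GammaD1// lnM ?posrE ?Gamma_gt0// addrC.
- exact: ln_Gamma_convex.
Qed.

(** * From moments to the digamma function *)

Section geometric_expansion.
Context {R : realType}.
Notation mu := (@lebesgue_measure R).
Context (w d : R -> R).
Context (w01 : forall x, 0 < x -> 0 < w x < 1).
Context (d0 : forall x, 0 < x -> 0 <= d x).
Context (moments : forall a, 0 < a ->
  mu.-integrable `]0, +oo[ (EFin \o (fun x => w x `^ (a - 1) * d x)) /\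
  (\int[mu]_(x in `]0%R, +oo[) (w x `^ (a - 1) * d x)%:E)%E = (a^-1)%:E).
Implicit Types (p q x : R) (n : nat).

Let term p q n x : R :=
  w x `^ (p + n%:R - 1) * d x - w x `^ (q + n%:R - 1) * d x.

Let termE p q n x : 0 < x ->
  term p q n x = (w x `^ (p - 1) - w x `^ (q - 1)) * d x * w x ^+ n.
Proof.
move=> x0; have /andP[w0 _] := w01 x0.
have shift a : w x `^ (a + n%:R - 1) = w x `^ (a - 1) * w x ^+ n.
  rewrite addrAC powRD; last by apply/implyP => _; rewrite gt_eqF.
  by rewrite powR_mulrn// ltW.
by rewrite /term !shift; ring.
Qed.

Let integrable_term p q n : 0 < p -> 0 < q ->
  mu.-integrable `]0, +oo[ (EFin \o term p q n).
Proof.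
move=> p0 q0; have pn : 0 < p + n%:R by rewrite ltr_wpDr.
have qn : 0 < q + n%:R by rewrite ltr_wpDr.
exact: (integrableB measurable_0y (moments pn).1 (moments qn).1).
Qed.

Let integral_term p q n : 0 < p -> 0 < q ->
  (\int[mu]_(x in `]0%R, +oo[) (term p q n x)%:E)%E =
  ((p + n%:R)^-1 - (q + n%:R)^-1)%:E.
Proof.
move=> p0 q0; have pn : 0 < p + n%:R by rewrite ltr_wpDr.
have qn : 0 < q + n%:R by rewrite ltr_wpDr.
rewrite /term; under eq_integral do rewrite EFinB.
rewrite (integralB measurable_0y (moments pn).1 (moments qn).1)/=.
by rewrite (moments pn).2 (moments qn).2.
Qed.

Let partial p q n x : \bar R := (\sum_(k < n) (term p q k x)%:E)%E.

Let phi p q x : R := (w x `^ (p - 1) - w x `^ (q - 1)) / (1 - w x) * d x.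

Let cvg_partial p q x : 0 < x -> partial p q n x @[n --> \oo] --> (phi p q x)%:E.
Proof.
move=> x0; have /andP[w0 w1] := w01 x0.
have w1N : 1 - w x != 0 by rewrite gt_eqF// subr_gt0.
have -> : partial p q ^~ x = (fun n => (phi p q x * (1 - w x ^+ n))%:E).
  apply/funext => n; rewrite /partial sumEFin; congr EFin.
  under eq_bigr do rewrite termE//.
  rewrite -mulr_sumr; have := subrX1 (w x) n; rewrite /phi => wn.
  have -> : 1 - w x ^+ n = (1 - w x) * \sum_(i < n) w x ^+ i.
    by rewrite -[LHS]opprB wn; ring.
  by field.
apply: cvg_EFin; first exact: nearW.
rewrite -[X in _ --> X]mulr1 -[X in _ * X]subr0.
apply: cvgM; first exact: cvg_cst.
apply: cvgB; first exact: cvg_cst.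
by apply: cvg_expr; rewrite gtr0_norm.
Qed.

Let term_ge0 p q n x : p <= q -> 0 < x -> 0 <= term p q n x.
Proof.
move=> pq x0; have /andP[w0 w1] := w01 x0.
rewrite termE// mulr_ge0 ?exprn_ge0 ?(ltW w0)// mulr_ge0 ?d0// subr_ge0.
by apply: ger_powR; rewrite ?w0 ?(ltW w1)// lerB.
Qed.

(** Expand 1 / (1 - w) as a geometric series. For p <= q all terms are nonnegative, so
    monotone convergence applies; the integrals of the terms are differences of
    moments, and these sum to the difference of digamma values. *)
Lemma geometric_digamma p q : 0 < p -> p <= q ->
  mu.-integrable `]0, +oo[ (EFin \o phi p q) /\
  (\int[mu]_(x in `]0%R, +oo[) (phi p q x)%:E)%E = (digamma q - digamma p)%:E.
Proof.
move=> p0 pq; have q0 := lt_le_trans p0 pq.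
have in0y x : `](0:R), +oo[%classic x -> 0 < x by rewrite /= in_itv/= andbT.
have mterm k : measurable_fun `](0:R), +oo[ (EFin \o term p q k).
  by case/integrableP: (integrable_term k p0 q0).
have mpartial n : measurable_fun `](0:R), +oo[ (partial p q n).
  by apply: emeasurable_sum => k; exact: mterm.
have phi0 x : 0 < x -> 0 <= phi p q x.
  move=> x0; have /andP[w0 w1] := w01 x0.
  rewrite mulr_ge0 ?d0// divr_ge0 ?subr_ge0 ?(ltW w1)//.
  by apply: ger_powR; rewrite ?w0 ?(ltW w1)// lerB.
have mphi : measurable_fun `](0:R), +oo[ (EFin \o phi p q).
  apply: (emeasurable_fun_cvg (partial p q)) => // x /in0y.
  exact: cvg_partial.
have int_partial n : (\int[mu]_(x in `]0%R, +oo[) partial p q n x)%E =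
    (\sum_(k < n) ((p + k%:R)^-1 - (q + k%:R)^-1))%:E.
  rewrite integral_sum//=.
    by rewrite -sumEFin; apply: eq_bigr => k _; exact: integral_term.
  by move=> k; exact: integrable_term.
have int_phi : (\int[mu]_(x in `]0%R, +oo[) (phi p q x)%:E)%E =
    (digamma q - digamma p)%:E.
  transitivity (\int[mu]_(x in `]0%R, +oo[) limn (partial p q ^~ x))%E.
    apply: eq_integral => x; rewrite inE => /in0y x0.
    by apply/esym/cvg_lim => //; exact: cvg_partial.
  have := @cvg_monotone_convergence _ _ _ mu _ measurable_0y (partial p q) mpartial.
  have p_ge0 n x : `](0:R), +oo[%classic x -> (0 <= partial p q n x)%E.
    by move=> /in0y x0; apply: sume_ge0 => k _; rewrite lee_fin term_ge0.
  have p_nd x : `](0:R), +oo[%classic x ->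
      {homo partial p q ^~ x : n m / (n <= m)%N >-> (n <= m)%E}.
    move=> /in0y x0; apply/nondecreasing_seqP => n.
    by rewrite /partial big_ord_recr/= leeDl// lee_fin term_ge0.
  move=> /(_ p_ge0 p_nd); under eq_cvg do rewrite int_partial.
  move=> /cvg_unique; apply => //.
  apply: cvg_EFin; first exact: nearW.
  by rewrite !digammaE//; exact: cvg_digamma_series.
split => //; apply: (ge0_integrable_0y _ phi0 int_phi).
exact/measurable_EFinP.
Qed.

End geometric_expansion.

Section power_difference.
Context {R : realType}.
Notation mu := (@lebesgue_measure R).

Definition power_difference (w : R -> R) (p q x : R) : R :=
  (w x `^ p - w x `^ q) / x.

(** The hypothesis w (1 - w) (1 + x)^2 = x, a quadratic equation whose two roots are
    x/(1+x) and 1/(1+x), rewrites dx/x as dx/(1+x)^2 divided by w (1 - w). *)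
Lemma integral_power_difference (w : R -> R) (p q : R) :
  (forall x, 0 < x -> 0 < w x < 1) ->
  (forall x, 0 < x -> w x * (1 - w x) * (1 + x) ^+ 2 = x) ->
  (forall x, 0 < x -> {for x, continuous w}) ->
  (forall a, 0 < a ->
    (\int[mu]_(x in `]0%R, +oo[) (w x `^ (a - 1) * (1 + x) ^- 2)%:E)%E
    = (a^-1)%:E) ->
  0 < p -> 0 < q ->
  mu.-integrable `]0, +oo[ (EFin \o power_difference w p q) /\
  (\int[mu]_(x in `]0%R, +oo[) (power_difference w p q x)%:E)%E
  = (digamma q - digamma p)%:E.
Proof.
move=> w01 wx cw moments p0 q0.
wlog pq : p q p0 q0 / p <= q => [wl|].
  have [|/ltW qp] := leP p q; first exact: wl.
  have [i] := wl q p q0 p0 qp.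
  move: (digamma p) (digamma q) => psi_p psi_q e.
  have -> : power_difference w p q = (fun x => - power_difference w q p x).
    by apply/funext => x; rewrite /power_difference -mulNr opprB.
  split; first exact: (integrableN i).
  under eq_integral do rewrite EFinN.
  rewrite integralN/=; last exact: integrable_add_def measurable_0y _ i.
  by rewrite e -EFinN opprB.
pose d x : R := (1 + x) ^- 2.
have d0 x : 0 < x -> 0 <= d x.
  by move=> x0; rewrite invr_ge0 exprn_ge0// addr_ge0// ltW.
apply: eq_integral_0y (@geometric_digamma R w d w01 d0 _ p q p0 pq) => [x x0|].
  have /andP[w0 w1] := w01 _ x0.
  have powB1 a : w x `^ (a - 1) = w x `^ a / w x.
    rewrite powRB; last by apply/implyP => _; rewrite gt_eqF.
    by rewrite powRr1// ltW.
  rewrite !powB1 /power_difference /d -[X in _ = _ / X](wx _ x0).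
  by field; rewrite !gt_eqF// ?subr_gt0// addr_gt0.
move=> a a0; split; last exact: moments.
apply: (ge0_integrable_0y _ _ (moments a a0)) => [|x x0].
  apply: measurable_funM; last first.
    by apply: continuous_measurable_fun_0y; exact: continuous_inv1D2.
  apply: (measurableT_comp (measurable_powR (a - 1))).
  exact: continuous_measurable_fun_0y.
by rewrite mulr_ge0 ?powR_ge0// d0.
Qed.

End power_difference.

(** * The two integrals *)

Theorem proposition4p1 (R : realType) (p q : R) (hp : 0 < p) (hq : 0 < q) :
  let mu := @lebesgue_measure R in
  let f := fun t : R =>
    (t `^ p / (1 + t) `^ p - t `^ q / (1 + t) `^ q) / t in
  let g := fun t : R =>
    (1 / (1 + t) `^ p - 1 / (1 + t) `^ q) / t in
  (mu.-integrable `]0%R, +oo[ (EFin \o f) /\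
   (\int[mu]_(t in `]0%R, +oo[) (f t)%:E = (digamma q - digamma p)%:E)%E) /\
  (mu.-integrable `]0%R, +oo[ (EFin \o g) /\
   (\int[mu]_(t in `]0%R, +oo[) (g t)%:E = (digamma q - digamma p)%:E)%E).
Proof.
move=> mu f g.
have inv1D (x : R) : 0 < x -> 0 < (1 + x)^-1 < 1.
  move=> x0; have x1 : 0 < 1 + x by rewrite addr_gt0.
  by apply/andP; split; [rewrite invr_gt0|rewrite invf_lt1// ltrDl].
have neq0 (x : R) : 0 < x -> 1 + x != 0 by move=> x0; rewrite gt_eqF// addr_gt0.
have powRV (x a : R) : 0 < x -> (1 + x)^-1 `^ a = ((1 + x) `^ a)^-1.
  move=> x0; have x1 : 0 < 1 + x by rewrite addr_gt0.
  by rewrite -(powR_inv1 (ltW x1)) powRAC powR_inv1// powR_ge0.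
split.
- apply: eq_integral_0y
    (@integral_power_difference R (fun x => 1 - (1 + x)^-1) p q _ _ _ _ hp hq).
  + move=> x x0; have ix : 0 <= (1 + x)^-1 by rewrite ltW//; case/andP: (inv1D x x0).
    have wE : 1 - (1 + x)^-1 = x * (1 + x)^-1 by field; exact: neq0.
    by rewrite /power_difference wE !(powRM _ (ltW x0) ix) !powRV.
  + by move=> x /inv1D/andP[? ?]; rewrite subr_gt0 gtrBl; apply/andP.
  + by move=> x /neq0 ?; field.
  + by move=> x /is_derive_frac; exact: is_derive_continuous.
  + exact: integral_frac_powR.
- apply: eq_integral_0y
    (@integral_power_difference R (fun x => (1 + x)^-1) p q _ _ _ _ hp hq).
  + by move=> x x0; rewrite /power_difference !powRV// /g !div1r.
  + exact: inv1D.
  + by move=> x /neq0 ?; field.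
  + by move=> x /is_derive_inv1D; exact: is_derive_continuous.
  + exact: integral_inv1D_powR.
Qed.
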